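(* Let $k\geq 2$ be an integer and let $G$ be a finite simple graph on $n\geq k+1$ vertices with exactly $t_k(n)+1$ edges, where $t_k(n)=(k-1)(n-k+2)+\binom{k-2}{2}$. Then $G$ contains a subgraph $H$ with minimum degree $\delta(H)\geq k$ and with at most $n-\dfrac{n}{4(k+1)^5\log_2 n}$ vertices.
   Context: All graphs are finite and simple; a subgraph of minimum degree at least $k$ is understood to be nonempty. $\delta(H)$ denotes the minimum degree of $H$. *)

(* Defs.v *)
From mathcomp Require Import all_boot all_order all_algebra.
From mathcomp Require Import reals exp.

Set Implicit Arguments.
Unset Strict Implicit.
Unset Printing Implicit Defensive.

(* Finite simple graphs whose vertices are drawn from an ambient finite type T.
   The vertex set is a component of the graph, so that a graph and its subgraphs
   have the same type. Edges are 2-element subsets of the vertex set. *)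
Record sgraph (T : finType) := SGraph {
  vertices : {set T};
  edges : {set {set T}};
  edges_simple :
    forall e : {set T}, e \in edges -> (e \subset vertices) /\ #|e| = 2
}.

Definition subgraph (T : finType) (H G : sgraph T) : Prop :=
  (vertices H \subset vertices G) /\ (edges H \subset edges G).

Definition degree (T : finType) (G : sgraph T) (v : T) : nat :=
  #|[set e in edges G | v \in e]|.

(* Every degree is less than #|vertices G|, so when G has a vertex the default
   value #|vertices G| does not affect the minimum (see min_degreeP). *)
Definition min_degree (T : finType) (G : sgraph T) : nat :=
  \big[minn/#|vertices G|]_(v in vertices G) degree G v.

Definition tk (k n : nat) : nat := (k - 1) * (n - k + 2) + 'C(k - 2, 2).

Definition log2 (R : realType) (x : R) : R := (ln x / ln 2)%R.

Lemma degree_ltn (T : finType) (G : sgraph T) (v : T) :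
  v \in vertices G -> degree G v < #|vertices G|.
Proof.
move=> vG; rewrite (cardsD1 v) vG ltnS.
have sub : [set e in edges G | v \in e] \subset
           (fun u => [set v; u]) @: (vertices G :\ v).
  apply/subsetP => e; rewrite inE => /andP[eG ve].
  have [eV e2] := edges_simple eG.
  have /cards1P[u eu] : #|e :\ v| == 1.
    by rewrite -eqSS -e2 (cardsD1 v e) ve.
  have ee : e = [set v; u] by rewrite -(setD1K ve) eu.
  apply/imsetP; exists u => //.
  have : u \in e :\ v by rewrite eu inE.
  by rewrite !inE => /andP[-> /(subsetP eV)].
exact: leq_trans (subset_leq_card sub) (leq_imset_card _ _).
Qed.

Lemma min_degreeP (T : finType) (G : sgraph T) (k : nat) :
  vertices G != set0 ->
  reflect (forall v, v \in vertices G -> k <= degree G v) (k <= min_degree G).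
Proof.
move=> V0; apply: (iffP idP) => [le v vG|le].
  apply: leq_trans le _; rewrite /min_degree.
  have := mem_index_enum v; elim: (index_enum T) => // a s IHs.
  rewrite inE big_cons => /orP[/eqP <-|/IHs le]; first by rewrite vG geq_minl.
  by case: ifP => // _; apply: leq_trans (geq_minr _ _) le.
rewrite /min_degree; apply: (big_ind (fun m => k <= m)) => //.
  have /set0Pn[w wG] := V0.
  exact: leq_trans (le w wG) (ltnW (degree_ltn wG)).
by move=> x y kx ky; rewrite leq_min kx.
Qed.

(* Main.v *)
Require Import Defs.
From mathcomp Require Import all_boot all_order all_algebra.
From mathcomp Require Import reals exp.
From mathcomp Require Import zify.

Set Implicit Arguments.
Unset Strict Implicit.
Unset Printing Implicit Defensive.

(* Write the excess of a vertex set A as e(A) - (k - 1)|A| + C(k, 2). If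
   |A| >= k and the excess of A is at least 1, then deleting vertices of degree
   < k one by one never gets down to k vertices, so A contains a nonempty set
   inducing minimum degree >= k, called a core. The given graph has excess 2.

   Take V of size >= k and excess >= 2, minimal, and drop edges until the excess
   is exactly 2. If some proper A of excess 1 misses a large part of V, a core
   inside A will do. Otherwise the minimal sets of excess 1 are cores, and by
   supermodularity of e their complements (the items) are pairwise disjoint with
   no edges between them. Every vertex of degree k lies in an item.

   If at least half of the vertices are neither of degree k nor adjacent to such
   a vertex, Turan's theorem picks many of them that can be deleted together.
   Otherwise the items cover a fraction 1 / (2 (k + 1)) of V. A dyadic
   pigeonhole, which costs the factor log n, gives m items of size >= 2^j. Let W
   be the rest of V. If W has no core, order W so that each vertex has at most
   k - 1 later neighbours; since the excess drops by exactly 1 per item, the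
   total shortfall from k - 1 is at most m + C(k, 2) - 2. When a set J of items
   is deleted, a vertex of W with k - 1 later neighbours needs only one more
   surviving neighbour, and can be deleted harmlessly if everything below it is
   gone; each of the O(m) deficient vertices survives if J meets a certain set
   of O(k) items at most once. Turan's theorem then provides J of size
   m / O(k^3). *)

(** * Independent sets and sparse hitting of set systems *)

Lemma subset_of_card (I : finType) (A : {set I}) (m : nat) :
  m <= #|A| -> exists2 B : {set I}, B \subset A & #|B| = m.
Proof.
move=> /card_geqP[s [us <- sA]]; exists [set x in s].
  by apply/subsetP => x; rewrite inE => /sA.
by rewrite cardsE; apply/card_uniqP.
Qed.

(** Greedy proof of Turan's bound $|J| \ge |A| / (1 + \bar d)$, freed of division. A vertex of
    minimum degree $d$ joins [J]; its closed neighbourhood, whose $d + 1$ vertices account for at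
    least $d(d+1)$ of the degree sum, is discarded. *)
Lemma turan (I : finType) (r : rel I) (A : {set I}) :
  symmetric r -> irreflexive r ->
  exists J : {set I},
    [/\ J \subset A, {in J &, forall u v, ~~ r u v} &
        #|A| ^ 2 <= #|J| * (#|A| + \sum_(u in A) #|[set v in A | r u v]|)].
Proof.
move=> rsym rirr; have [m] := ubnP #|A|.
elim: m A => // m IHm A /ltnSE leAm.
have [->|/set0Pn[v0 v0A]] := eqVneq A set0.
  by exists set0; split; rewrite ?sub0set ?cards0 // => u v; rewrite inE.
pose dg u := #|[set v in A | r u v]|.
have [v vA vmin] : exists2 v, v \in A & {in A, forall u, dg v <= dg u}.
  by case: (arg_minnP dg v0A) => v; exists v.
pose N := v |: [set u in A | r v u].
have NA : N \subset A.
  by rewrite subUset sub1set vA; apply/subsetP => u; rewrite inE => /andP[].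
have cN : #|N| = (dg v).+1 by rewrite cardsU1 inE rirr andbF.
pose B := A :\: N.
have cB : #|A| = #|B| + (dg v).+1.
  by rewrite -(cardsID N A) (setIidPr NA) cN addnC.
have /IHm[J [JB Jind Jcard]] : #|B| < m by move: cB leAm; lia.
have vJ : v \notin J.
  by apply/negP => /(subsetP JB); rewrite !inE eqxx.
exists (v |: J); split.
- by rewrite subUset sub1set vA (subset_trans JB) ?subsetDl.
- have nJ u : u \in J -> ~~ r v u.
    by move=> /(subsetP JB); rewrite !inE negb_or => /andP[/andP[_]]; case: (u \in A).
  move=> x y; rewrite !inE => /orP[/eqP->|xJ] /orP[/eqP->|yJ]; rewrite ?rirr ?nJ //.
    by rewrite rsym nJ.
  exact: Jind.
have sumE : dg v * (dg v).+1 + \sum_(u in B) #|[set v in B | r u v]|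
            <= \sum_(u in A) dg u.
  rewrite [leqRHS](big_setID N) /= (setIidPr NA) leq_add //.
    rewrite -cN mulnC -sum_nat_const; apply: leq_sum => u uN.
    exact/vmin/(subsetP NA).
  apply: leq_sum => u _; apply: subset_leq_card; apply/subsetP => w.
  by rewrite !inE => /andP[/andP[_ ->]].
rewrite cardsU1 vJ /=; rewrite cB.
rewrite -/(dg _) in sumE *.
move: (#|J|) (#|B|) (\sum_(u in B) _) (\sum_(u in A) _) (dg v) sumE Jcard.
move=> j b SB SA d sumE Jcard.
(* Cauchy-Schwarz: b^2 <= j x implies (b + a)^2 <= (j + 1) (x + a^2). *)
pose a := d.+1; pose x := b + SB.
apply: (@leq_trans ((1 + j) * (x + a ^ 2))); last first.
  by rewrite leq_mul2l; apply/orP; right; rewrite /a /x; nia.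
have h2 : 2 * a * b <= j * a ^ 2 + x.
  rewrite -leq_sqr; apply: leq_trans (nat_AGM2 _ _).
  by move: Jcard; rewrite -/x; nia.
by move: Jcard h2; rewrite -/x -/a; nia.
Qed.

(** [turan] is applied to the graph joining two indices that share some [P w]; each [w] adds at most
    [#|P w| * (#|P w| - 1)] to its degree sum. *)
Lemma sparse_hitting (I U : finType) (A : {set I}) (D : {set U})
    (P : U -> {set I}) :
  exists J : {set I},
    [/\ J \subset A, {in D, forall w, #|J :&: P w| <= 1} &
        #|A| ^ 2 <= #|J| * (#|A| + \sum_(w in D) #|P w| * (#|P w| - 1))].
Proof.
pose r u v := (u != v) && [exists w in D, (u \in P w) && (v \in P w)].
have rsym : symmetric r.
  by move=> u v; rewrite /r eq_sym; under eq_existsb => w do rewrite andbA andbAC -andbA.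
have rirr : irreflexive r by move=> u; rewrite /r eqxx.
have [J [JA Jind Jcard]] := turan A rsym rirr.
exists J; split => //.
  move=> w wD; apply/card_le1_eqP => u v; rewrite !inE => /andP[uJ uP] /andP[vJ vP].
  apply/eqP; apply: contraT => uv; have /negP[] := Jind _ _ uJ vJ.
  by rewrite /r eq_sym uv; apply/existsP; exists w; rewrite wD uP.
apply: leq_trans Jcard _; rewrite leq_mul2l leq_add2l; apply/orP; right.
have step u : #|[set v in A | r u v]| <= \sum_(w in D) (u \in P w) * (#|P w| - 1).
  apply: (@leq_trans #|\bigcup_(w in D | u \in P w) (P w :\ u)|).
    apply: subset_leq_card; apply/subsetP => v; rewrite !inE => /andP[_ /andP[uv]].
    case/existsP => w /andP[wD /andP[uw vw]]; apply/bigcupP; exists w; first exact/andP.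
    by rewrite !inE eq_sym uv.
  apply: leq_trans (_ : \sum_(w in D | u \in P w) #|P w :\ u| <= _).
    elim/big_rec2: _ => [|w m X _ le]; first by rewrite cards0.
    by apply: leq_trans (leq_card_setU _ _) _; rewrite leq_add2l.
  rewrite big_mkcondr /=; apply: leq_sum => w _; case: ifP => // uw.
  by rewrite mul1n (cardsD1 u (P w)) uw addKn.
apply: (@leq_trans (\sum_(u in A) \sum_(w in D) (u \in P w) * (#|P w| - 1))).
  by apply: leq_sum => u _; apply: step.
rewrite exchange_big /=.
apply: leq_sum => w _; rewrite -big_distrl /= leq_mul2r; apply/orP; right.
rewrite -sum1_card [leqRHS]big_mkcond [leqLHS]big_mkcond /=.
by apply: leq_sum => u _; case: ifP => // _; case: (u \in P w).
Qed.

(** * Edge counts, cores and degenerate orders *)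

Lemma double_bin2 (k : nat) : 2 * 'C(k, 2) = k * (k - 1).
Proof. by case: k => // k; rewrite mul2n -(bin1 (_ - 1)) subn1 mul_bin_diag mul2n. Qed.

Definition adj (T : finType) (E : {set {set T}}) (u v : T) : bool :=
  [set u; v] \in E.

Definition nbrs (T : finType) (E : {set {set T}}) (X : {set T}) (v : T) :
  {set T} := [set u in X | adj E v u].

Definition edges_in (T : finType) (E : {set {set T}}) (X : {set T}) : nat :=
  #|[set e in E | e \subset X]|.

Definition core (T : finType) (E : {set {set T}}) (k : nat) (X : {set T}) :
  bool := [forall v in X, k <= #|nbrs E X v|].

Section EdgeSets.

Variables (T : finType) (E : {set {set T}}).
Hypothesis E2 : forall e, e \in E -> #|e| = 2.
Implicit Types (X Y A B W : {set T}) (u v w : T).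

Lemma adj_sym : symmetric (adj E).
Proof. by move=> u v; rewrite /adj setUC. Qed.

Lemma adj_irr : irreflexive (adj E).
Proof. by move=> u; apply/negP => /E2; rewrite setUid cards1. Qed.

Lemma coreP k X :
  reflect (forall v, v \in X -> k <= #|nbrs E X v|) (core E k X).
Proof.
by apply: (iffP forallP) => [h v vX|h v]; [have := h v; rewrite vX|apply/implyP/h].
Qed.

Lemma edges_in0 : edges_in E set0 = 0.
Proof.
apply: eq_card0 => e; rewrite !inE subset0; apply/negP => /andP[/E2 h /eqP e0].
by rewrite e0 cards0 in h.
Qed.

Lemma card_incident X v : v \in X ->
  #|[set e in [set e in E | e \subset X] | v \in e]| = #|nbrs E X v|.
Proof.
move=> vX; rewrite -(@card_in_imset _ _ (fun u => [set v; u])) /=.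
  apply: eq_card => e; rewrite !inE; apply/idP/imsetP.
    move=> /andP[/andP[eE eX] ve].
    have /cards1P[u eu] : #|e :\ v| == 1 by rewrite -eqSS -(E2 eE) (cardsD1 v e) ve.
    have ee : e = [set v; u] by rewrite -(setD1K ve) eu.
    exists u => //; rewrite !inE /adj -ee eE andbT.
    by apply: (subsetP eX); rewrite ee !inE eqxx orbT.
  case=> u; rewrite inE => /andP[uX uv] ->; rewrite -/(adj E v u) uv subUset.
  by rewrite !sub1set vX uX !inE eqxx.
move=> u u'; rewrite !inE => /andP[_ vu] _ eq.
have : u \in [set v; u'] by rewrite -eq !inE eqxx orbT.
by rewrite !inE => /orP[/eqP uv|/eqP//]; rewrite uv adj_irr in vu.
Qed.

Lemma edges_in_D1 X v : v \in X ->
  edges_in E X = edges_in E (X :\ v) + #|nbrs E X v|.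
Proof.
move=> vX; rewrite /edges_in -(cardsID [set e : {set T} | v \in e]) addnC.
congr (_ + _).
  apply: eq_card => e; rewrite !inE subsetD1.
  by case: (v \in e); rewrite ?andbF ?andbT.
by rewrite -card_incident //; apply: eq_card => e; rewrite !inE.
Qed.

Lemma edges_in_le_bin X : edges_in E X <= 'C(#|X|, 2).
Proof.
rewrite -cards_draws; apply: subset_leq_card; apply/subsetP => e.
by rewrite !inE => /andP[/E2-> ->].
Qed.

Lemma edges_in_supermodular A B :
  edges_in E A + edges_in E B <= edges_in E (A :|: B) + edges_in E (A :&: B).
Proof.
rewrite /edges_in -cardsUI leq_add //; apply: subset_leq_card; apply/subsetP => e.
  rewrite !inE -andb_orr => /andP[-> /orP[]] h /=.
    exact: subset_trans h (subsetUl _ _).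
  exact: subset_trans h (subsetUr _ _).
by rewrite !inE subsetI => /andP[/andP[-> ->] /andP[_ ->]].
Qed.

Lemma edges_in_supermodular_lt A B u v :
  u \in A :\: B -> v \in B :\: A -> adj E u v ->
  edges_in E A + edges_in E B < edges_in E (A :|: B) + edges_in E (A :&: B).
Proof.
rewrite !inE => /andP[uB uA] /andP[vA vB] uv.
rewrite /edges_in -cardsUI -addSn leq_add //.
  apply: proper_card; apply/properP; split.
    apply/subsetP => e; rewrite !inE -andb_orr => /andP[-> /orP[]] h /=.
      exact: subset_trans h (subsetUl _ _).
    exact: subset_trans h (subsetUr _ _).
  exists [set u; v]; rewrite !inE -/(adj E u v) uv !subUset !sub1set ?inE.
    by rewrite uA vB orbT.
  by rewrite (negbTE uB) (negbTE vA) andbF.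
apply: subset_leq_card; apply/subsetP => e.
by rewrite !inE subsetI => /andP[/andP[-> ->] /andP[_ ->]].
Qed.

Lemma core_of_edges k A : k <= #|A| ->
  (k - 1) * #|A| + 1 <= edges_in E A + 'C(k, 2) ->
  exists X, [/\ X \subset A, k < #|X| & core E k X].
Proof.
move=> kA eA.
pose P X := (k <= #|X|) && ((k - 1) * #|X| + 1 <= edges_in E X + 'C(k, 2)).
have /minset_exists[X /minsetP[/andP[kX eX] minX] XA] : P A by apply/andP.
(* On exactly [k] vertices the left side of [eX] is $k(k-1) + 1$, the right side at most
   $2\binom{k}{2} = k(k-1)$. *)
have ltkX : k < #|X|.
  rewrite ltn_neqAle kX andbT; apply/eqP => kE; have := edges_in_le_bin X.
  by move: eX (double_bin2 k); rewrite -kE; lia.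
exists X; split => //; apply/coreP => v vX; rewrite leqNgt; apply/negP => dv.
have cX := cardsD1 v X; rewrite vX in cX.
have eD := edges_in_D1 vX.
have : X :\ v = X.
  apply: minX; rewrite ?subD1set //; apply/andP; split; first by lia.
  have : (k - 1) * #|X| = (k - 1) + (k - 1) * #|X :\ v| by rewrite cX; lia.
  by move: eX eD dv; lia.
by move/setP/(_ v); rewrite !inE eqxx vX.
Qed.

Definition parents (rho : T -> nat) W w : {set T} :=
  [set u in W | adj E w u && (rho w < rho u)].

(** A set without cores always has a vertex with fewer than [k] neighbours in it; this gets rank 0
    and the other ranks shift up by one. Each edge is counted once, at its lower end, whence the
    sum. *)
Lemma degenerate_order k W :
  (forall X, X \subset W -> X != set0 -> ~~ core E k X) ->
  exists rho : T -> nat,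
    [/\ {in W &, injective rho}, {in W, forall w, #|parents rho W w| < k} &
        \sum_(w in W) #|parents rho W w| = edges_in E W].
Proof.
have [m] := ubnP #|W|; elim: m W => // m IHm W /ltnSE leWm noc.
have [->|W0] := eqVneq W set0.
  exists (fun=> 0); split; rewrite ?big_set0 ?edges_in0 //.
    by move=> x y; rewrite inE.
  by move=> x; rewrite inE.
have := noc W (subxx _) W0; rewrite negb_forall => /existsP[v].
rewrite negb_imply -ltnNge => /andP[vW dv].
have cW := cardsD1 v W; rewrite vW in cW.
have [|X XW X0|rho [inj par sumE]] := IHm (W :\ v); first by lia.
  by apply: noc X0; apply: subset_trans XW (subD1set _ _).
pose rho' u := if u == v then 0 else (rho u).+1.
have parv : parents rho' W v = nbrs E W v.
  apply/setP => u; rewrite !inE /rho' eqxx; case: eqP => [->|_]; rewrite ?andbT //.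
  by rewrite adj_irr.
have parW u : u \in W :\ v -> parents rho' W u = parents rho (W :\ v) u.
  rewrite !inE => /andP[uv uW]; apply/setP => x; rewrite !inE /rho' (negbTE uv).
  by case: eqP => // _; rewrite ltn0 !andbF.
exists rho'; split.
- move=> x y xW yW; rewrite /rho'; case: eqP => [->|xv]; case: eqP => // yv [] eq.
  by apply: inj => //; rewrite !inE; [case: eqP xv|case: eqP yv].
- move=> w wW; have [->|wv] := eqVneq w v; first by rewrite parv.
  by rewrite parW ?par // !inE wv.
rewrite (big_setD1 v) //= parv (edges_in_D1 vW) addnC -sumE; congr (_ + _).
by apply: eq_bigr => u uW; rewrite parW.
Qed.

End EdgeSets.

(** * Removing disjoint items: robust neighbourhoods and excess *)

Lemma exists_notin_card (I : finType) (A B : {set I}) :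
  #|A| < #|B| -> exists2 x, x \in B & x \notin A.
Proof.
move=> ltAB; apply/subsetPn; apply: contraL ltAB => /subset_leq_card.
by rewrite -leqNgt.
Qed.

(** In a minimal valid [Y], every point has a critical block that misses it and leaves exactly [r]
    points of [Y]. If [Y] had over [2 * r] points, such a block [S] would hold more than [r] of
    them; the critical block of one of these, disjoint from [S], would put more than [r] points into
    [Y :\: S]. *)
Lemma robust_subset (I : finType) (F : {set {set I}}) (N : {set I}) (r : nat) :
  trivIset F -> {in F, forall S : {set I}, r <= #|N :\: S|} ->
  exists Y : {set I},
    [/\ Y \subset N, #|Y| <= 2 * r & {in F, forall S : {set I}, r <= #|Y :\: S|}].
Proof.
move=> tF hN; pose P (Y : {set I}) := [forall S in F, r <= #|Y :\: S|].
have PN : P N by apply/forallP => S; apply/implyP => /hN.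
have [Y /minsetP[PY minY] YN] := minset_exists PN.
have hY S : S \in F -> r <= #|Y :\: S|.
  by move=> SF; have := forallP PY S; rewrite SF.
exists Y; split => //; rewrite leqNgt; apply/negP => ltY.
have crit y : y \in Y ->
    exists S, [/\ S \in F, y \notin S, #|Y :\: S| = r & r < #|Y :&: S|].
  move=> yY; have /forallPn[S] : ~~ P (Y :\ y).
    by apply/negP => /minY/(_ (subD1set _ _))/setP/(_ y); rewrite !inE eqxx yY.
  rewrite negb_imply -ltnNge => /andP[SF lt]; exists S.
  have := hY S SF; have := cardsID S Y.
  have eqD : (Y :\ y) :\: S = (Y :\: S) :\ y by rewrite !setDDl setUC.
  have := cardsD1 y (Y :\: S); rewrite -eqD !inE yY andbT.
  by case: (y \in S) => /=; move: lt ltY; split => //; lia.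
have [y yY] : exists y, y \in Y by apply/set0Pn; rewrite -card_gt0; lia.
have [S [SF yS eS ltS]] := crit y yY.
have [y'] : exists y, y \in Y :&: S by apply/set0Pn; rewrite -card_gt0; lia.
rewrite inE => /andP[y'Y y'S]; have [S' [S'F y'S' _ ltS']] := crit y' y'Y.
have disj : [disjoint S' & S].
  by move/trivIsetP: tF; apply=> //; apply: contraNneq y'S' => ->.
have : #|Y :&: S'| <= #|Y :\: S|.
  apply/subset_leq_card/subsetP => z; rewrite !inE => /andP[-> zS'].
  by rewrite (disjointFr disj zS').
by rewrite eS leqNgt ltS'.
Qed.

Section RemovableFamily.

Variables (T : finType) (E : {set {set T}}) (k : nat) (V : {set T}).
Variable F : {set {set T}}.
Hypothesis E2 : forall e, e \in E -> #|e| = 2.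
Hypothesis k2 : 2 <= k.
Hypothesis coreV : core E k V.
Hypothesis edgesV : edges_in E V + 'C(k, 2) = (k - 1) * #|V| + 2.
Hypothesis F0 : F != set0.
Hypothesis trivF : trivIset F.
Hypothesis subF : {in F, forall S : {set T}, S \subset V}.
Hypothesis coreF : {in F, forall S : {set T}, core E k (V :\: S)}.
Hypothesis edgesF : {in F, forall S : {set T},
  (k - 1) * #|V :\: S| + 1 <= edges_in E (V :\: S) + 'C(k, 2)}.
Hypothesis nadjF : {in F &, forall S S' : {set T}, S != S' ->
  {in S & S', forall u v, ~~ adj E u v}}.

Local Notation W := (V :\: cover F).

(** Supermodularity for the complement of one item and that of the others, whose union is [V]: each
    item lowers the excess, which starts at 2, by at most 1. *)
Lemma edges_in_D_cover (F' : {set {set T}}) : F' \subset F ->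
  (k - 1) * #|V :\: cover F'| + 2 <=
    edges_in E (V :\: cover F') + #|F'| + 'C(k, 2).
Proof.
have [m] := ubnP #|F'|; elim: m F' => // m IHm F' /ltnSE leFm F'F.
have [->|/set0Pn[S SF']] := eqVneq F' set0.
  by rewrite /cover big_set0 setD0 cards0 addn0 edgesV.
have cF' := cardsD1 S F'; rewrite SF' in cF'.
have subD : F' :\ S \subset F := subset_trans (subD1set _ _) F'F.
have IH := IHm (F' :\ S) ltac:(lia) subD.
have SF : S \in F := subsetP F'F S SF'.
have covE : cover F' = S :|: cover (F' :\ S) by rewrite /cover (big_setD1 S).
have disj : [disjoint S & cover (F' :\ S)].
  apply/bigcup_disjointP => S'; rewrite !inE => /andP[nS S'F'].
  have S'F := subsetP F'F _ S'F'.
  by move/trivIsetP: trivF => /(_ S S' SF S'F); apply; rewrite eq_sym.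
pose A := V :\: cover (F' :\ S); pose B := V :\: S.
have AIB : A :&: B = V :\: cover F' by rewrite covE -setDUr setUC.
have AUB : A :|: B = V.
  apply/setP => x; rewrite !inE -andb_orl -negb_and.
  by case: (boolP (x \in S)) => xS; rewrite ?(disjointFr disj xS) ?andbF.
have := edges_in_supermodular E A B; have := cardsUI A B; rewrite AUB AIB.
have := edgesF SF; rewrite -/A -/B -/A in IH *.
set w := #|V :\: cover F'| => eS cE eSup.
have : (k - 1) * #|V| + (k - 1) * w = (k - 1) * #|A| + (k - 1) * #|B|.
  by rewrite -!mulnDr cE.
move: IH eS eSup edgesV cF'; move: #|F'| #|F' :\ S|; clear; lia.
Qed.

(** * Survival along a degenerate order *)

Variable rho : T -> nat.
Hypothesis rho_inj : {in W &, injective rho}.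
Hypothesis par_lt : {in W, forall w, #|parents E rho W w| < k}.
Hypothesis par_sum : \sum_(w in W) #|parents E rho W w| = edges_in E W.
Hypothesis W0 : W != set0.

Local Notation par := (parents E rho W).

(* A vertex of W that is not deficient has k - 1 neighbours above it, so it
   survives as soon as one neighbour below it or in F survives. Deficient
   vertices are never to be removed, hence they count as sources. *)
Definition up : rel T :=
  [rel x y | [&& x \in W, y \in W, adj E x y & rho x < rho y]].

Definition deficient : {set T} := [set w in W | #|par w| < k - 1].

Definition touches w (S : {set T}) : bool := [exists v in S, adj E w v].

Definition source (J : {set {set T}}) w : bool :=
  (w \in deficient) || [exists S in F :\: J, touches w S].

(** Survival spreads upwards: a vertex of [W] goes only if no source lies at or below it along [up].
    Hence the parents of an alive vertex are alive. *)
Definition alive (J : {set {set T}}) : {set T} :=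
  [set w in W | [exists x in W, source J x && connect up x w]].

Definition survivors (J : {set {set T}}) : {set T} :=
  alive J :|: cover (F :\: J).

Lemma aliveP J w : reflect
  (w \in W /\ exists x, [/\ x \in W, source J x & connect up x w])
  (w \in alive J).
Proof.
rewrite [w \in alive J]inE; apply: (iffP andP) => [[wW /existsP[x /and3P[xW sx xw]]]|].
  by split=> //; exists x.
by case=> wW [x [xW sx xw]]; split=> //; apply/existsP; exists x; rewrite xW sx.
Qed.

Lemma source_alive J w : w \in W -> source J w -> w \in alive J.
Proof. by move=> wW sw; apply/aliveP; split=> //; exists w. Qed.

Lemma alive_up J w u : w \in alive J -> u \in W -> connect up w u -> u \in alive J.
Proof.
move=> /aliveP[wW [x [xW sx xw]]] uW wu; apply/aliveP; split=> //.
by exists x; split=> //; apply: connect_trans wu.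
Qed.

Lemma parents_alive J w : w \in alive J -> par w \subset alive J.
Proof.
move=> wA; have /aliveP[wW _] := wA; apply/subsetP => u; rewrite inE.
by case/and3P => uW wu lt; apply: (alive_up wA uW); apply/connect1/and4P.
Qed.

Lemma not_deficient w : w \in W -> w \notin deficient -> #|par w| = k - 1.
Proof.
by move=> wW; rewrite inE wW /= -leqNgt => ge; have := par_lt wW; lia.
Qed.

Lemma in_WE x : x \in V -> (x \in W) = (x \notin cover F).
Proof. by move=> xV; rewrite inE xV andbT. Qed.

(* The lowest vertex below c has all its neighbours in W above it, hence too
   few of them unless it meets two members of F: removing one member of F
   leaves a core. *)
Lemma below_deficient_or_two_items c : c \in W ->
  (exists2 x, x \in deficient & connect up x c) \/
  (exists x S S', [/\ x \in W, connect up x c, S \in F, S' \in F & S != S'] /\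
     touches x S /\ touches x S').
Proof.
move=> cW.
have [x /andP[xW xc] xmin] : exists2 x, (x \in W) && connect up x c &
    forall y, (y \in W) && connect up y c -> rho x <= rho y.
  have cP : (c \in W) && connect up c c by rewrite cW connect0.
  by case: (@arg_minnP _ c (fun y => (y \in W) && connect up y c) rho cP) => x; exists x.
have [xD|xnD] := boolP (x \in deficient); first by left; exists x.
have parx := not_deficient xW xnD.
have nbW y : y \in W -> adj E x y -> y \in par x.
  move=> yW xy; rewrite inE yW xy /= ltnNge; apply/negP => le.
  have lt : rho y < rho x.
    rewrite ltn_neqAle le andbT; apply/eqP => /(rho_inj yW xW) yx.
    by rewrite yx (adj_irr E2) in xy.
  have := xmin y; rewrite yW (connect_trans (connect1 _) xc) /=.
    by move=> /(_ isT); rewrite leqNgt lt.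
  by apply/and4P; split=> //; rewrite adj_sym.
have [xV xF] : x \in V /\ x \notin cover F by move: xW; rewrite inE => /andP[].
have find (X : {set T}) : X \subset V -> x \in X -> core E k X ->
    exists S y, [/\ S \in F, y \in S, y \in X & adj E x y].
  move=> XV xX /coreP/(_ x xX) dx.
  have [|y] := @exists_notin_card _ (par x) (nbrs E X x).
    by rewrite parx; apply: leq_trans dx; rewrite subn1 prednK // ltnW.
  rewrite inE => /andP[yX xy] yp; have yV := subsetP XV _ yX.
  have : y \in cover F.
    by apply: contraR yp => yF; apply: nbW => //; rewrite in_WE.
  by case/bigcupP => S SF yS; exists S, y.
have [S [y [SF yS _ xy]]] := find V (subxx _) xV coreV.
have xS : x \in V :\: S.
  by rewrite inE xV andbT; apply: contra xF => xS; apply/bigcupP; exists S.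
have [S' [y' [S'F y'S' y'V xy']]] := find _ (subsetDl _ _) xS (coreF SF).
right; exists x, S, S'; split; last first.
  by split; apply/existsP; [exists y; rewrite yS|exists y'; rewrite y'S'].
split=> //; apply: contraTneq y'V => ->; by rewrite inE y'S'.
Qed.

(** [Q] is empty if a deficient vertex lies at or below [c]; otherwise it consists of two items
    touched there, one of which escapes [J]. *)
Lemma alive_certificate c : exists Q : {set {set T}}, c \in W ->
  [/\ Q \subset F, #|Q| <= 2 &
      forall J : {set {set T}}, #|J :&: Q| <= 1 -> c \in alive J].
Proof.
have [cW|] := boolP (c \in W); last by exists set0.
have [[x xD xc]|[x [S [S' [[xW xc SF S'F nSS'] [tS tS']]]]]] :=
    below_deficient_or_two_items cW.
  exists set0 => _; split=> [||J _]; rewrite ?sub0set ?cards0 //.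
  have xW : x \in W by move: xD; rewrite inE => /andP[].
  by apply: (alive_up _ cW xc); apply: source_alive xW _; rewrite /source xD.
exists [set S; S'] => _; split=> [||J hJ].
- by rewrite subUset !sub1set SF.
- by rewrite cards2; case: (_ != _).
apply: (alive_up _ cW xc); apply: source_alive xW _; apply/orP; right.
have [SJ|SJ] := boolP (S \in J); last by apply/existsP; exists S; rewrite inE SJ SF.
apply/existsP; exists S'; rewrite inE S'F tS' !andbT.
apply/negP => S'J; move: hJ; rewrite (setIidPr _) ?cards2 ?nSS' //.
by rewrite subUset !sub1set SJ.
Qed.

(** As [w] is a source, its parents survive, and $k - |par(w)|$ more neighbours are needed. Some
    come from [C0], lower neighbours in [W] with certificates of at most two items each; the rest
    from [Y], neighbours inside items, chosen to tolerate the loss of any one item. Each missing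
    neighbour costs at most two items. *)
Lemma degree_certificate w : exists P : {set {set T}}, w \in deficient ->
  [/\ P \subset F, #|P| <= 2 * (k - #|par w|) &
    forall J : {set {set T}}, #|J :&: P| <= 1 -> k <= #|nbrs E (survivors J) w|].
Proof.
have [wD|] := boolP (w \in deficient); last by exists set0.
have wW : w \in W by move: wD; rewrite inE => /andP[].
have [wV wF] : w \in V /\ w \notin cover F by move: wW; rewrite inE => /andP[].
have [q hq] := fin_all_exists alive_certificate.
pose Ch := [set c in W | adj E w c && (rho c < rho w)].
pose N := [set v in cover F | adj E w v].
have [C0 C0Ch cC0] := subset_of_card (geq_minl #|Ch| (k - #|par w|)).
have parlt := par_lt wW.
(* Neighbours of [w] in the core [V :\: S] lie in [par w], [Ch] or [N :\: S]. Either [C0] is all of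
   [Ch], or the left side is 0. *)
have hN : {in F, forall S : {set T}, k - #|par w| - #|C0| <= #|N :\: S|}.
  move=> S SF; have wS : w \in V :\: S.
    by rewrite inE wV andbT; apply: contra wF => wS; apply/bigcupP; exists S.
  have /coreP/(_ w wS) := coreF SF.
  have : #|nbrs E (V :\: S) w| <= #|par w| + #|Ch| + #|N :\: S|.
    apply: leq_trans (_ : #|par w :|: Ch :|: (N :\: S)| <= _); last first.
      apply: leq_trans (leq_card_setU _ _) _; rewrite leq_add2r.
      exact: leq_card_setU.
    apply/subset_leq_card/subsetP => u; rewrite !inE => /andP[/andP[uS uV] wu].
    rewrite uS uV wu /= !andbT; case: (boolP (u \in cover F)) => uF; rewrite ?orbT //=.
    rewrite !orbF -neq_ltn; apply: contraTneq wu => /rho_inj wu.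
    by rewrite wu ?(adj_irr E2) // in_WE.
  rewrite cC0 => h1 h2; move: (leq_trans h2 h1).
  by move: #|par w| #|Ch| #|N :\: S| => p c n; clear; lia.
have [Y [YN cY hY]] := robust_subset trivF hN.
have YF y : y \in Y -> y \in cover F /\ adj E w y.
  by move=> /(subsetP YN); rewrite inE => /andP[].
have C0W c : c \in C0 -> [/\ c \in W, adj E w c & rho c < rho w].
  by move=> /(subsetP C0Ch); rewrite inE => /and3P[].
exists (pblock F @: Y :|: \bigcup_(c in C0) q c) => _; split.
- rewrite subUset; apply/andP; split.
    by apply/subsetP => _ /imsetP[y /YF[yF _] ->]; apply: pblock_mem.
  by apply/bigcupsP => c /C0W[cW _ _]; have [] := hq c cW.
- apply: leq_trans (leq_card_setU _ _) _.
  have l1 : #|pblock F @: Y| <= #|Y| := leq_imset_card _ _.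
  have l2 : #|\bigcup_(c in C0) q c| <= \sum_(c in C0) 2.
    elim/big_rec2: _ => [|c m X cC le]; first by rewrite cards0.
    apply: leq_trans (leq_card_setU _ _) _; apply: leq_add le.
    by have [cW _ _] := C0W _ cC; have [] := hq c cW.
  rewrite sum_nat_const in l2; apply: leq_trans (leq_add l1 l2) _.
  apply: leq_trans (leq_add cY (leqnn _)) _.
  by rewrite [_ * 2]mulnC -mulnDr subnK // cC0 geq_minr.
move=> J hJ.
(* At most one item meeting [Y] lies in [J]; [S] is that item, or any member of [F] if there is
   none. *)
have [S SF YS] : exists2 S, S \in F & {in Y :\: S, forall y, pblock F y \notin J}.
  have [/eqP|/set0Pn[S]] := boolP (J :&: pblock F @: Y == set0).
    move=> J0; have /set0Pn[S SF] := F0; exists S => // y; rewrite inE => /andP[_ yY].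
    apply/negP => yJ; move/setP: J0 => /(_ (pblock F y)).
    by rewrite inE yJ inE imset_f.
  rewrite inE => /andP[SJ /imsetP[y0 y0Y SE]]; exists S.
    by rewrite SE; apply: pblock_mem; have [] := YF _ y0Y.
  move=> y; rewrite inE => /andP[yS yY]; apply: contra yS => yJ.
  have -> : S = pblock F y.
    move/card_le1_eqP: hJ; apply; rewrite !inE ?SJ ?yJ ?imset_f //.
    by rewrite SE imset_f.
  by rewrite mem_pblock; have [] := YF _ yY.
have wA : w \in alive J by apply: source_alive wW _; rewrite /source wD.
have sub : par w :|: C0 :|: (Y :\: S) \subset nbrs E (survivors J) w.
  apply/subsetP => u; rewrite 2!inE => /orP[/orP[up|uC]|uY].
  - rewrite inE inE (subsetP (parents_alive wA) _ up) /=.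
    by move: up; rewrite inE => /and3P[].
  - have [uW wu _] := C0W _ uC; rewrite inE wu andbT inE.
    have [_ _ ->] // := hq u uW.
    apply: leq_trans hJ; apply/subset_leq_card/setIS.
    exact: subset_trans (bigcup_sup u uC) (subsetUr _ _).
  rewrite inE; have := YS _ uY; move: uY; rewrite inE => /andP[_ /YF[uF ->]] uJ.
  rewrite andbT inE; apply/orP; right; apply/bigcupP; exists (pblock F u).
    by rewrite inE uJ pblock_mem.
  by rewrite mem_pblock.
apply: leq_trans (subset_leq_card sub).
have d1 : [disjoint par w & C0].
  apply/pred0P => u /=; apply/negbTE/negP => /andP[]; rewrite inE => /and3P[_ _ l1].
  by move=> /C0W[_ _]; rewrite ltnNge (ltnW l1).
have d2 : [disjoint par w :|: C0 & Y :\: S].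
  apply/pred0P => u /=; apply/negbTE/negP => /andP[uW]; rewrite inE => /andP[_ /YF[uF _]].
  have : u \in W by move: uW; rewrite inE => /orP[|/C0W[]//]; rewrite inE => /andP[].
  by rewrite inE uF.
rewrite cardsU (disjoint_setI0 d2) cards0 subn0 cardsU (disjoint_setI0 d1).
rewrite cards0 subn0; have : #|C0| <= k - #|par w| by rewrite cC0 geq_minr.
move: (hY S SF) parlt; move: #|par w| #|C0| #|Y :\: S| => p c y; clear; lia.
Qed.

(** An alive vertex with [k - 1] parents has one more surviving neighbour: in a surviving item if it
    is a source, else its predecessor on a path from a source. A vertex of a surviving item loses no
    neighbour: those in [cover F] lie in the same item, those in [W] are sources. *)
Lemma survivors_core (J : {set {set T}}) :
  {in deficient, forall w, k <= #|nbrs E (survivors J) w|} ->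
  core E k (survivors J).
Proof.
move=> hD; apply/coreP => w; rewrite inE => /orP[wA|/bigcupP[S]].
  have [/hD//|wnD] := boolP (w \in deficient).
  have /aliveP[wW [x [xW sx xw]]] := wA; have parw := not_deficient wW wnD.
  suff [y [yS wy yp]] : exists y, [/\ y \in survivors J, adj E w y & y \notin par w].
    have -> : k = #|y |: par w|.
      by rewrite cardsU1 yp parw add1n subn1 prednK // ltnW.
    apply/subset_leq_card; rewrite subUset sub1set inE yS wy /=.
    apply/subsetP => u up; rewrite inE inE (subsetP (parents_alive wA) _ up) /=.
    by move: up; rewrite inE => /and3P[].
  case/connectP: xw sx => p; case/lastP: p => [_ /= wx|p z].
    rewrite -wx /source (negbTE wnD) /= => /existsP[S /andP[SFJ /existsP[y /andP[yS wy]]]].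
    exists y; split=> //; first by rewrite inE; apply/orP; right; apply/bigcupP; exists S.
    rewrite inE negb_and; apply/orP; left; rewrite inE negb_and negbK; apply/orP; left.
    by apply/bigcupP; exists S => //; move: SFJ; rewrite inE => /andP[].
  rewrite last_rcons rcons_path => /andP[xp /and4P[yW zW yz lt]] wz sx; subst z.
  exists (last x p); split; last 2 first.
  - by rewrite adj_sym.
  - by rewrite inE negb_and negb_and -leqNgt (ltnW lt) !orbT.
  rewrite inE; apply/orP; left; apply: (alive_up (source_alive xW sx) yW).
  by apply/connectP; exists p.
rewrite inE => /andP[SJ SF] wS.
have wV := subsetP (subF SF) _ wS.
apply: leq_trans (coreP _ _ _ coreV _ wV) _; apply/subset_leq_card/subsetP => u.
rewrite inE => /andP[uV wu]; rewrite inE wu andbT inE.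
have [/bigcupP[S' S'F uS']|uF] := boolP (u \in cover F).
  apply/orP; right; apply/bigcupP; exists S' => //; rewrite inE S'F andbT.
  have [->//|nS] := eqVneq S' S.
  have := nadjF SF S'F; rewrite eq_sym => /(_ nS _ _ wS uS').
  by rewrite wu.
apply/orP; left; apply: source_alive; first by rewrite in_WE.
apply/orP; right; apply/existsP; exists S; rewrite inE SJ SF /=.
by apply/existsP; exists w; rewrite wS adj_sym.
Qed.

(** * Counting deficiencies and choosing the items to delete *)

Lemma deficient_neq0 : deficient != set0.
Proof.
have /set0Pn[w0 w0W] := W0.
have [w wW wmax] : exists2 w, w \in W & {in W, forall u, rho u <= rho w}.
  by case: (@arg_maxnP _ w0 (mem W) rho w0W) => w; exists w.
apply/set0Pn; exists w; rewrite inE wW /=.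
have -> : par w = set0.
  apply/setP => u; rewrite inE in_set0; apply/negbTE/negP => /and3P[uW _].
  by rewrite ltnNge wmax.
by rewrite cards0 subn_gt0.
Qed.

(** The sum is $(k-1)|W| - e(W)$, as parents count the edges of [W], and [W] has excess at least $2
    - |F|$. *)
Lemma sum_deficiency :
  \sum_(w in W) (k - 1 - #|par w|) + 2 <= #|F| + 'C(k, 2).
Proof.
have h := edges_in_D_cover (subxx F).
have : \sum_(w in W) (k - 1 - #|par w|) + edges_in E W = (k - 1) * #|W|.
  rewrite -par_sum -big_split /= mulnC -sum_nat_const; apply: eq_bigr => w wW.
  by rewrite subnK // -ltnS subn1 prednK ?par_lt // ltnW.
by move: h; clear; lia.
Qed.

Lemma removable_subfamily_of_order :
  exists J X : {set _}, [/\ J \subset F,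
    #|F| <= #|J| * (1 + 4 * (k + 1) * 'C(k, 2)),
    X \subset V :\: cover J, X != set0 & core E k X].
Proof.
have [P hP] := fin_all_exists degree_certificate.
have [J [JF hJ cJ]] := sparse_hitting F deficient P.
have F_gt0 : 0 < #|F| by rewrite card_gt0.
exists J, (survivors J); split=> //.
- have h12 : \sum_(w in deficient) #|P w| * (#|P w| - 1) <=
             \sum_(w in deficient) 4 * (k + 1) * (k - 1 - #|par w|).
    apply: leq_sum => w wD; have [_ cP _] := hP w wD.
    move: wD; rewrite inE => /andP[_]; move: cP; move: #|P w| #|par w| => c p cP pk.
    apply: leq_trans (leq_mul cP (leq_sub2r 1 cP)) _.
    (* With $d + 1$ the deficiency of [w], the claim is at worst $(2d+4)(2d+3) \le 4(k+1)(d+1)$, an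
       equality for $p = d = 0$. *)
    have [d ->] : exists d, k = p + d.+2 by exists (k - p - 2); lia.
    by clear; nia.
  have h23 : \sum_(w in deficient) 4 * (k + 1) * (k - 1 - #|par w|) <=
             4 * (k + 1) * \sum_(w in W) (k - 1 - #|par w|).
    rewrite big_distrr /= [leqRHS](big_setID deficient) /=.
    by rewrite (setIidPr _) ?leq_addr //; apply/subsetP => w; rewrite inE => /andP[].
  have C_gt0 : 0 < 'C(k, 2) by rewrite bin_gt0.
  have arith (f j C a s1 s3 : nat) : s3 + 2 <= f + C -> 0 < f -> 0 < C ->
      s1 <= a * s3 -> f ^ 2 <= j * (f + s1) -> f <= j * (1 + a * C).
    clear; move=> hs f0 C0 h13 hj.
    rewrite -(leq_pmul2l f0) mulnn; apply: leq_trans hj _.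
    rewrite mulnCA leq_mul2l; apply/orP; right.
    have h3 : s3 <= f * C by nia.
    by rewrite mulnDr muln1 leq_add2l mulnCA (leq_trans h13) // leq_mul2l h3 orbT.
  exact: arith sum_deficiency F_gt0 C_gt0 (leq_trans h12 h23) cJ.
- apply/subsetP => x; rewrite [x \in survivors J]inE in_setD.
  case/orP => [/aliveP[]|/bigcupP[S]].
    rewrite inE => /andP[xF xV _]; rewrite xV andbT; apply: contra xF => /bigcupP[S SJ xS].
    by apply/bigcupP; exists S => //; apply: subsetP JF _ SJ.
  rewrite inE => /andP[SJ SF] xS; rewrite (subsetP (subF SF) _ xS) andbT.
  apply/negP => /bigcupP[S' S'J xS']; have S'F := subsetP JF _ S'J.
  have nS : S != S' by apply: contraNneq SJ => ->.
  by move/trivIsetP: trivF => /(_ _ _ SF S'F nS) /disjointFr/(_ xS); rewrite xS'.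
(* A deficient vertex is a source for every [J], so something survives. *)
- have /set0Pn[w wD] := deficient_neq0; apply/set0Pn; exists w; rewrite inE.
  by rewrite source_alive // /source ?wD //; move: wD; rewrite inE => /andP[].
apply: survivors_core => w wD; have [_ _] := hP w wD; apply; exact: hJ.
Qed.

End RemovableFamily.

(** If the part outside all items contains a core, the whole of [F] can go; otherwise that part has
    a degenerate order. *)
Lemma removable_subfamily (T : finType) (E : {set {set T}}) (k : nat)
    (V : {set T}) (F : {set {set T}}) :
  (forall e, e \in E -> #|e| = 2) -> 2 <= k -> core E k V ->
  edges_in E V + 'C(k, 2) = (k - 1) * #|V| + 2 ->
  F != set0 -> trivIset F ->
  {in F, forall S : {set T}, S \subset V} ->
  {in F, forall S : {set T}, core E k (V :\: S)} ->
  {in F, forall S : {set T},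
    (k - 1) * #|V :\: S| + 1 <= edges_in E (V :\: S) + 'C(k, 2)} ->
  {in F &, forall S S' : {set T}, S != S' ->
    {in S & S', forall u v, ~~ adj E u v}} ->
  V :\: cover F != set0 ->
  exists J X : {set _}, [/\ J \subset F,
    #|F| <= #|J| * (1 + 4 * (k + 1) * 'C(k, 2)),
    X \subset V :\: cover J, X != set0 & core E k X].
Proof.
move=> E2 k2 cV eV F0 tF sF cF eF nF W0.
have [/existsP[X /and3P[XW X0 cX]]|noc] :=
    boolP [exists X : {set T}, [&& X \subset V :\: cover F, X != set0 & core E k X]].
  by exists F, X; split=> //; rewrite leq_pmulr // addn_gt0.
have noc' (X : {set T}) : X \subset V :\: cover F -> X != set0 -> ~~ core E k X.
  move=> XW X0; apply: contra noc => cX; apply/existsP; exists X; exact/and3P.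
have [rho [inj par sumE]] := degenerate_order E2 noc'.
exact: (@removable_subfamily_of_order T E k V F _ _ _ _ _ _ _ _ _ _ rho).
Qed.

(** * Dyadic pigeonhole and scattered deletions *)

Lemma leq_sum_expn2 (n L : nat) :
  n < 2 ^ L -> n <= \sum_(i < L) 2 ^ i * (2 ^ i <= n).
Proof.
elim: L => [|L IHL] ltn; first by move: ltn; rewrite expn0 ltnS leqn0 => /eqP->.
rewrite big_ord_recr /=; have [le|lt] := leqP (2 ^ L) n; last first.
  by apply: leq_trans (IHL lt) (leq_addr _ _).
have -> : \sum_(i < L) 2 ^ i * (2 ^ i <= n) = \sum_(i < L) 2 ^ i.
  apply: eq_bigr => i _; rewrite (leq_trans _ le) ?muln1 //.
  by rewrite leq_exp2l // ltnW.
have : \sum_(i < L) 2 ^ i + 1 = 2 ^ L.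
  elim: L {IHL ltn le} => [|L IHL]; first by rewrite big_ord0.
  by rewrite big_ord_recr /= addnAC IHL expnS mul2n addnn.
by rewrite muln1; move: ltn; rewrite expnS; lia.
Qed.

(** The size of [S] is at most the sum of the powers of two not above it, so nested classes with
    only a lower bound on [#|S|] suffice; the best of [L] carries an average share. *)
Lemma dyadic_class (T : finType) (F : {set {set T}}) (L : nat) :
  {in F, forall S : {set T}, #|S| < 2 ^ L} ->
  exists j, \sum_(S in F) #|S| <= L * (2 ^ j * #|[set S in F | 2 ^ j <= #|S|]|).
Proof.
move=> ltF; pose f (i : nat) := 2 ^ i * #|[set S in F | 2 ^ i <= #|S|]|.
have le : \sum_(S in F) #|S| <= \sum_(i < L) f i.
  apply: (@leq_trans (\sum_(S in F) \sum_(i < L) 2 ^ i * (2 ^ i <= #|S|))).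
    by apply: leq_sum => S SF; apply/leq_sum_expn2/ltF.
  rewrite exchange_big /=; apply: leq_sum => i _; rewrite -big_distrr /= leq_mul2l.
  apply/orP; right; rewrite -[leqRHS]sum1_card [leqRHS]big_mkcond [leqLHS]big_mkcond /=.
  by apply: leq_sum => S _; rewrite inE; case: (S \in F) => //=; case: (2 ^ i <= #|S|).
case: L le {ltF} => [|L] le; first by exists 0; rewrite big_ord0 in le.
have [j maxE] : {j : 'I_L.+1 | \max_(i < L.+1) f i = f j}.
  by apply: eq_bigmax; rewrite card_ord.
exists j; apply: leq_trans le _; apply: (@leq_trans (\sum_(i < L.+1) f j)).
  by apply: leq_sum => i _; rewrite -maxE;
     apply: (leq_bigmax_cond (F := fun i : 'I_L.+1 => f i)).
by rewrite sum_nat_const card_ord.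
Qed.

(* Each vertex of degree > k only has to keep k of k + 1 chosen neighbours. *)
Lemma core_remove_scattered (T : finType) (E : {set {set T}}) (k : nat)
    (V A : {set T}) :
  0 < k -> core E k V -> A \subset V -> A != set0 ->
  {in A & V, forall u w, adj E u w -> k < #|nbrs E V w|} ->
  exists I : {set T},
    [/\ I \subset A, core E k (V :\: I), V :\: I != set0 &
        #|A| ^ 2 <= #|I| * (#|A| + #|V| * ((k + 1) * k))].
Proof.
move=> k0 /coreP cV AV /set0Pn[a aA] hA.
pose D := [set w in V | k < #|nbrs E V w|].
have /fin_all_exists[P hP] w : exists P : {set T}, w \in D ->
    P \subset nbrs E V w /\ #|P| = k + 1.
  have [|_] := boolP (w \in D); last by exists set0.
  by rewrite inE addn1 => /andP[_ /subset_of_card[P sP cP]]; exists P.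
have [I [IA hI cI]] := sparse_hitting A D P.
have keep w : w \in D -> k <= #|P w :\: I|.
  move=> wD; have [_ cP] := hP w wD; have := cardsID I (P w).
  by rewrite cP setIC; have := hI w wD; move: #|_| #|_| => x y; clear; lia.
exists I; split=> //.
- apply/coreP => w; rewrite inE => /andP[wI wV].
  have [wD|wD] := boolP (w \in D).
    apply: leq_trans (keep w wD) _; have [sP _] := hP w wD.
    apply/subset_leq_card/subsetP => u; rewrite !inE => /andP[-> /(subsetP sP)].
    by rewrite inE.
  apply: leq_trans (cV w wV) _; apply/subset_leq_card/subsetP => u.
  rewrite !inE => /andP[uV wu]; rewrite uV wu !andbT; apply/negP => /(subsetP IA) uA.
  move: wD; rewrite inE wV /= => /negP; apply; apply: hA uA wV _.
  by rewrite adj_sym.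
- have [w] : exists w, w \in nbrs E V a.
    apply/set0Pn; rewrite -card_gt0; apply: leq_trans k0 (cV a _).
    exact: subsetP AV a aA.
  rewrite inE => /andP[wV aw].
  have wD : w \in D by rewrite inE wV (hA a).
  have /set0Pn[u] : P w :\: I != set0.
    by rewrite -card_gt0 (leq_trans k0) ?keep.
  rewrite inE => /andP[uI uP]; apply/set0Pn; exists u; rewrite inE uI /=.
  by have [/subsetP/(_ u uP)] := hP w wD; rewrite inE => /andP[].
apply: leq_trans cI _; rewrite leq_mul2l leq_add2l; apply/orP; right.
apply: (@leq_trans (\sum_(w in D) (k + 1) * k)).
  by apply: leq_sum => w wD; have [_ ->] := hP w wD; rewrite addnK.
rewrite sum_nat_const leq_mul2r; apply/orP; right; apply/subset_leq_card.
by apply/subsetP => w; rewrite inE => /andP[].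
Qed.

(** * Vertex-minimal graphs of excess 2 *)

Section MinimalGraph.

Variables (T : finType) (E : {set {set T}}) (k : nat) (V : {set T}).
Hypothesis E2 : forall e, e \in E -> #|e| = 2.
Hypothesis k2 : 2 <= k.
Hypothesis kV : k <= #|V|.
Hypothesis edgesV : edges_in E V + 'C(k, 2) = (k - 1) * #|V| + 2.
Hypothesis minV : forall A : {set T}, A \proper V -> k <= #|A| ->
  edges_in E A + 'C(k, 2) <= (k - 1) * #|A| + 1.

(** On [k] vertices the excess is at most 0, on [k + 1] at most $k^2 - (k-1)(k+1) = 1$. *)
Lemma minimal_card : k + 2 <= #|V|.
Proof.
have := edges_in_le_bin E2 V; have := double_bin2 k; have := double_bin2 #|V|.
move: edgesV kV; case: (ltngtP #|V| (k + 1)) => [lt|gt|->]; first last.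
- move: (edges_in E V) 'C(k + 1, 2) 'C(k, 2) => e c d; move: k2; clear; nia.
- by move: gt; clear; lia.
move=> eV kV'; have cV : #|V| = k by move: lt kV'; clear; lia.
move: eV; rewrite cV.
move: (edges_in E V) 'C(k, 2) => e d; move: k2; clear; nia.
Qed.

Lemma minimal_core : core E k V.
Proof.
apply/coreP => v vV; rewrite leqNgt; apply/negP => dv.
have cV := cardsD1 v V; rewrite vV in cV.
have VvV : V :\ v \proper V by rewrite properD1.
have := minimal_card; have := edges_in_D1 E2 vV; have := minV VvV.
move: edgesV dv; rewrite cV; move: #|V :\ v| (edges_in E V) (edges_in E (V :\ v)).
move: #|nbrs E V v| 'C(k, 2) => d c n e e'; clear => eV dv hmin eD ge.
by have := hmin ltac:(lia); rewrite mulnDr muln1 in eV; lia.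
Qed.

(** Excess 1 is the most that [minV] leaves to a proper subset of size at least [k]. Complements of
    the inclusion-minimal such sets are the items. *)
Definition cotight (A : {set T}) : bool :=
  [&& A \proper V, k <= #|A| & edges_in E A + 'C(k, 2) == (k - 1) * #|A| + 1].

Lemma cotight_intro (A : {set T}) : A \proper V -> k <= #|A| ->
  (k - 1) * #|A| + 1 <= edges_in E A + 'C(k, 2) -> cotight A.
Proof.
by move=> AV kA eA; rewrite /cotight AV kA /= eqn_leq eA minV.
Qed.

Lemma minset_cotight_core (A : {set T}) : minset cotight A -> core E k A.
Proof.
move=> /minsetP[/and3P[AV kA /eqP eA] minA]; apply/coreP => v vA.
have [X [XA kX cX]] : exists X : {set T}, [/\ X \subset A, k < #|X| & core E k X].
  by apply: core_of_edges => //; rewrite eA.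
have ltkA := leq_trans kX (subset_leq_card XA).
rewrite leqNgt; apply/negP => dv.
have cA := cardsD1 v A; rewrite vA in cA; have eD := edges_in_D1 E2 vA.
have : A :\ v = A.
  apply: minA; rewrite ?subD1set //; apply: cotight_intro.
  - exact: sub_proper_trans (subD1set _ _) AV.
  - by move: ltkA cA; clear; lia.
  move: eA eD dv; rewrite cA mulnDr muln1; clear; lia.
by move/setP/(_ v); rewrite !inE eqxx vA.
Qed.

(** Uncrossing. The intersection has excess at most 0, or else minimality would make it equal to
    both sets. By supermodularity the union has excess at least 2, so it is [V]; an edge between the
    complements would raise the excess of [V] to 3. *)
Lemma minset_cotight_neq (A B : {set T}) :
  minset cotight A -> minset cotight B -> A != B -> k <= #|A :&: B| ->
  A :|: B = V /\ {in V :\: A & V :\: B, forall u v, ~~ adj E u v}.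
Proof.
move=> mA mB nAB kAB.
have /minsetP[/and3P[AV kA /eqP eA] _] := mA.
have /minsetP[/and3P[BV kB /eqP eB] _] := mB.
have IV : A :&: B \proper V by apply: sub_proper_trans (subsetIl _ _) AV.
have ltI : edges_in E (A :&: B) + 'C(k, 2) < (k - 1) * #|A :&: B| + 1.
  rewrite ltnNge; apply/negP => /(cotight_intro IV kAB) cI.
  have eqA := minsetinf mA cI (subsetIl _ _).
  by have := minsetinf mB cI (subsetIr _ _); move/eqP; rewrite eqA (negbTE nAB).
have cE : (k - 1) * #|A :|: B| + (k - 1) * #|A :&: B| =
          (k - 1) * #|A| + (k - 1) * #|B| by rewrite -!mulnDr cardsUI.
have UE : A :|: B = V.
  apply/eqP; rewrite eqEproper subUset (proper_sub AV) (proper_sub BV) /=.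
  apply/negP => UV; have kU : k <= #|A :|: B|.
    exact: leq_trans kA (subset_leq_card (subsetUl _ _)).
  have := minV UV kU; have := edges_in_supermodular E A B.
  by move: ltI cE eA eB; clear; lia.
split=> // u v; rewrite !inE => /andP[uA uV] /andP[vB vV]; apply/negP => uv.
have uB : u \in B :\: A by move: uV; rewrite -UE !inE (negbTE uA).
have vA : v \in A :\: B by move: vV; rewrite -UE !inE (negbTE vB) orbF.
have := edges_in_supermodular_lt uB vA uv.
rewrite setUC setIC UE addnC.
by move: ltI cE eA eB edgesV; rewrite UE; clear; lia.
Qed.

Theorem minimal_graph_small_core : exists X : {set T},
  [/\ X \subset V, X != set0, core E k X &
      #|V| <= 4 * (k + 1) ^ 5 * trunc_log 2 #|V| * (#|V| - #|X|)].
Proof.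
set l := trunc_log 2 #|V|; set M := 4 * (k + 1) ^ 5 * l.
have k0 : 0 < k by apply: leq_trans k2.
have Vge := minimal_card; have coreV := minimal_core.
have V_gt1 : 1 < #|V| by move: Vge; clear; lia.
have l_gt0 : 0 < l by rewrite trunc_log_gt0.
have Mge : k + 2 <= M.
  apply: (@leq_trans (4 * (k + 1) ^ 5)).
    have : (k + 1) ^ 1 <= (k + 1) ^ 5 by rewrite leq_pexp2l // addn1.
    by rewrite expn1; move: ((k + 1) ^ 5); clear; lia.
  by rewrite leq_pmulr.
(* It suffices to find a core avoiding a set [Y] of at least $|V| / M$ vertices. *)
have subcase (X Y : {set T}) : X \subset V :\: Y -> Y \subset V -> X != set0 ->
    core E k X -> #|V| <= M * #|Y| ->
    exists X : {set T}, [/\ X \subset V, X != set0, core E k X &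
      #|V| <= M * (#|V| - #|X|)].
  move=> XVY YV X0 cX le; exists X; split=> //.
    exact: subset_trans XVY (subsetDl _ _).
  apply: leq_trans le _; rewrite leq_mul2l; apply/orP; right.
  have := subset_leq_card XVY; have := cardsID Y V; rewrite (setIidPr YV).
  by move: #|X| #|Y| #|V| #|_| => x y v d; clear; lia.
have [/existsP[A /andP[/and3P[AV kA /eqP eA] big]]|nobig] :=
    boolP [exists A : {set T}, cotight A && (#|V| <= M * #|V :\: A|)].
  have [X [XA kX cX]] : exists X : {set T}, [/\ X \subset A, k < #|X| & core E k X].
    by apply: core_of_edges => //; rewrite eA.
  apply: (@subcase X (V :\: A)) => //.
  - rewrite setDDr setDv set0U subsetI XA andbT.
    exact: subset_trans XA (proper_sub AV).
  - exact: subsetDl.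
  - by rewrite -card_gt0; apply: leq_ltn_trans kX.
have small (A : {set T}) : cotight A -> M * #|V :\: A| < #|V|.
  move=> cA; rewrite ltnNge; apply: contra nobig => le; apply/existsP; exists A.
  by rewrite cA.
pose B := [set v in V | #|nbrs E V v| == k].
(* A vertex of [V] outside [NB] has only neighbours of degree above [k]. *)
pose NB := B :|: \bigcup_(u in B) nbrs E V u.
have NBV : NB \subset V.
  rewrite subUset; apply/andP; split; first by apply/subsetP => v; rewrite inE => /andP[].
  by apply/bigcupsP => u _; apply/subsetP => v; rewrite inE => /andP[].
have cNB : #|NB| <= (k + 1) * #|B|.
  apply: leq_trans (leq_card_setU _ _) _; rewrite mulnDl mul1n addnC leq_add2r.
  apply: (@leq_trans (\sum_(u in B) k)); last by rewrite sum_nat_const mulnC.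
  elim/big_rec2: _ => [|u m X uB le]; first by rewrite cards0.
  apply: leq_trans (leq_card_setU _ _) _; apply: leq_add le.
  by move: uB; rewrite inE => /andP[_ /eqP->].
have [leA|ltA] := leqP #|V| (2 * #|V :\: NB|).
  have [|||I [IA cI I0 leI]] := @core_remove_scattered T E k V (V :\: NB) k0 coreV.
  - exact: subsetDl.
  - by rewrite -card_gt0; move: leA V_gt1; clear; lia.
  - move=> u w; rewrite in_setD => /andP[uN uV] wV uw.
    rewrite ltn_neqAle (coreP _ _ _ coreV) // andbT eq_sym.
    apply: contra uN => dw; rewrite in_setU; apply/orP; right; apply/bigcupP; exists w.
      by rewrite inE wV.
    by rewrite inE uV adj_sym.
  apply: (@subcase (V :\: I) I) => //; first exact: subset_trans IA (subsetDl _ _).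
  have a_gt0 : 0 < #|V :\: NB| by move: leA V_gt1; clear; lia.
  suff arith (v i a L : nat) : 0 < a -> 0 < L -> v <= 2 * a ->
      a ^ 2 <= i * (a + v * ((k + 1) * k)) -> v <= 4 * (k + 1) ^ 5 * L * i.
    exact: arith a_gt0 l_gt0 leA leI.
  move: k v i a L; clear => k v i a l a0 l0 leA leI.
  have h : a <= i * (1 + 2 * ((k + 1) * k)).
    rewrite -(leq_pmul2l a0) mulnn; apply: leq_trans leI _.
    rewrite [leqRHS]mulnCA leq_mul2l; apply/orP; right.
    by move: (leq_mul leA (leqnn ((k + 1) * k))); move: ((k + 1) * k); clear; lia.
  apply: leq_trans leA _; apply: leq_trans (leq_mul (leqnn 2) h) _.
  apply: (@leq_trans (4 * (k + 1) ^ 5 * i)); last first.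
    by rewrite leq_mul2r leq_pmulr ?orbT.
  rewrite mulnA mulnAC leq_mul2r; apply/orP; right.
  have -> : (k + 1) ^ 5 = (k + 1) ^ 2 * (k + 1) ^ 3 by rewrite -expnD.
  have := expn_gt0 (k + 1) 3; rewrite addn1 /= => e3.
  apply: (@leq_trans (4 * (k.+1 ^ 2 * 1))); first by clear; nia.
  by rewrite !leq_mul2l e3 !orbT.
pose F := [set V :\: A | A in [set A : {set T} | minset cotight A]].
have FP S : S \in F -> [/\ S \subset V, minset cotight (V :\: S) & V :\: (V :\: S) = S].
  case/imsetP => A; rewrite inE => mA ->; have /minsetP[/and3P[AV _ _] _] := mA.
  have DD : V :\: (V :\: A) = A by rewrite setDDr setDv set0U (setIidPr (proper_sub AV)).
  by split; rewrite ?subsetDl ?DD.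
have smallF S : S \in F -> M * #|S| < #|V|.
  by move=> /FP[_ /minsetP[cS _] SE]; have := small _ cS; rewrite SE.
have pairF S S' : S \in F -> S' \in F -> S != S' ->
    [disjoint S & S'] /\ {in S & S', forall u v, ~~ adj E u v}.
  move=> SF S'F nS; have [SV mS SE] := FP _ SF; have [S'V mS' S'E] := FP _ S'F.
  have nD : V :\: S != V :\: S' by apply: contra nS => /eqP eq; rewrite -SE eq S'E.
  (* Each item has fewer than $|V|/(k+2)$ vertices, so two of them leave more than $k|V|/(k+2) \ge
     k$. *)
  have kI : k <= #|(V :\: S) :&: (V :\: S')|.
    rewrite -setDUr; have := cardsID (S :|: S') V.
    have -> : V :&: (S :|: S') = S :|: S' by apply/setIidPr; rewrite subUset SV.
    have h1 : (k + 2) * #|S| < #|V|.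
      by apply: leq_ltn_trans (smallF _ SF); rewrite leq_mul2r Mge orbT.
    have h2 : (k + 2) * #|S'| < #|V|.
      by apply: leq_ltn_trans (smallF _ S'F); rewrite leq_mul2r Mge orbT.
    have hU : #|S :|: S'| <= #|S| + #|S'| := leq_card_setU S S'.
    suff arith (s s' u d v : nat) : (k + 2) * s < v -> (k + 2) * s' < v ->
        u <= s + s' -> k + 2 <= v -> u + d = v -> k <= d by exact: arith h1 h2 hU Vge.
    move: k s s' u d v; clear => k s s' u d v l1 l2 lu lv ev.
    rewrite leqNgt; apply/negP => ltd; have : v + 1 <= s + s' + k by lia.
    by nia.
  have [UE nadj] := minset_cotight_neq mS mS' nD kI; split; last by rewrite SE S'E in nadj.
  rewrite -setI_eq0 -SE -S'E -setDUr UE setDv //.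
have trivF : trivIset F.
  by apply/trivIsetP => S S' SF S'F nS; have [] := pairF _ _ SF S'F nS.
have BF : B \subset cover F.
  apply/subsetP => v; rewrite inE => /andP[vV /eqP dv].
  (* Deleting a vertex of degree [k] lowers the excess by 1; the complement of a minimal cotight set
     inside the rest is an item containing [v]. *)
  have ct : cotight (V :\ v).
    have cV := cardsD1 v V; rewrite vV in cV.
    apply: cotight_intro; first by rewrite properD1.
      by move: cV Vge; clear; lia.
    have := edges_in_D1 E2 vV; move: edgesV; rewrite dv cV mulnDr muln1.
    by move: k2; clear; lia.
  have [A mA AV] := minset_exists ct; apply/bigcupP; exists (V :\: A).
    by apply/imsetP; exists A => //; rewrite inE.
  by rewrite inE vV andbT; apply/negP => /(subsetP AV); rewrite !inE eqxx.
(* $2|S| \le M|S| < |V| < 2^{l+1}$, so [l] dyadic classes are enough. *)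
have ltF : {in F, forall S : {set T}, #|S| < 2 ^ l}.
  move=> S SF; have := ltn_trans (smallF _ SF) (@trunc_log_ltn 2 #|V| isT).
  rewrite -/l expnS => lt; rewrite -(ltn_pmul2l (isT : 0 < 2)).
  by apply: leq_ltn_trans lt; rewrite leq_mul2r (leq_trans _ Mge) ?orbT // addn2.
have [j] := dyadic_class ltF; set Fj := [set S in F | _] => lej.
have FjF : Fj \subset F by apply/subsetP => S; rewrite inE => /andP[].
have leV : #|V| <= 2 * ((k + 1) * (l * (2 ^ j * #|Fj|))).
  have cB : #|B| <= l * (2 ^ j * #|Fj|).
    apply: leq_trans (subset_leq_card BF) (leq_trans _ lej).
    exact: leq_card_cover.
  have : #|V| <= 2 * #|NB|.
    move: ltA (cardsID NB V); rewrite (setIidPr NBV).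
    by move: #|V| #|NB| #|_| => v n d; clear; lia.
  move=> h; apply: leq_trans h _; rewrite leq_mul2l /=.
  by apply: leq_trans cNB _; rewrite leq_mul2l cB orbT.
have Fj0 : Fj != set0.
  rewrite -card_gt0 lt0n; apply: contraTneq leV => ->.
  by rewrite !muln0 -ltnNge ltnW.
(* If the items of [Fj] exhaust [V], a single one is a core, as no edges join it to the others, and
   it is small. *)
have [W0|W0] := eqVneq (V :\: cover Fj) set0.
  have /set0Pn[S SFj] := Fj0; have SF := subsetP FjF _ SFj.
  have [SV mS SE] := FP _ SF.
  apply: (@subcase S (V :\: S)); rewrite ?subsetDl ?SE //.
  - rewrite -card_gt0; apply: leq_trans (_ : 2 ^ j <= _); first by rewrite expn_gt0.
    by move: SFj; rewrite inE => /andP[].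
  - apply/coreP => v vS; apply: leq_trans (coreP _ _ _ coreV _ (subsetP SV _ vS)) _.
    apply/subset_leq_card/subsetP => u; rewrite !inE => /andP[uV vu]; rewrite vu andbT.
    have : u \in cover Fj by apply: contraT => un; rewrite -(in_set0 u) -W0 inE un.
    case/bigcupP => S' S'Fj uS'; have [->//|nS] := eqVneq S S'.
    have [_ nadj] := pairF _ _ SF (subsetP FjF _ S'Fj) nS.
    by have := nadj _ _ vS uS'; rewrite vu.
  have := cardsID S V; rewrite (setIidPr SV).
  suff arith (s d v m : nat) : k + 2 <= m -> m * s < v -> s + d = v -> v <= m * d.
    exact: arith Mge (smallF _ SF).
  by move: k s d v m; clear => k s d v m; nia.
have [||||||J [X [JF leJ XV X0 cX]]] :=
    @removable_subfamily T E k V Fj E2 k2 coreV edgesV Fj0.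
- exact: trivIsetS FjF trivF.
- by move=> S /(subsetP FjF)/FP[].
- by move=> S /(subsetP FjF)/FP[_ /minset_cotight_core].
- by move=> S /(subsetP FjF)/FP[_ /minsetP[/and3P[_ _ /eqP->]]].
- move=> S S' /(subsetP FjF) SF /(subsetP FjF) S'F nS.
  by have [] := pairF _ _ SF S'F nS.
- by [].
have trivJ : trivIset J := trivIsetS (subset_trans JF FjF) trivF.
apply: (@subcase X (cover J)) => //.
  by apply/bigcupsP => S /(subsetP JF)/(subsetP FjF)/FP[].
have cJ : #|J| * 2 ^ j <= #|cover J|.
  rewrite -(eqP trivJ) -sum_nat_const; apply: leq_sum => S /(subsetP JF).
  by rewrite inE => /andP[].
apply: leq_trans leV _; apply: leq_trans (_ : M * (#|J| * 2 ^ j) <= _); last first.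
  by rewrite leq_mul2l cJ orbT.
(* After substituting for [C], this comes down to $2(k+1)(1 + 2(k+1)k(k-1)) \le 4(k+1)^5$. *)
suff arith (f i C p L : nat) : f <= i * (1 + 4 * (k + 1) * C) ->
    2 * C = k * (k - 1) ->
    2 * ((k + 1) * (L * (p * f))) <= 4 * (k + 1) ^ 5 * L * (i * p).
  exact: arith leJ (double_bin2 k).
move: k k2 f i C p L; clear => k k2 f i C p l le C2.
apply: (@leq_trans (2 * ((k + 1) * (l * (p * (i * (1 + 4 * (k + 1) * C))))))).
  by rewrite !leq_mul2l le !orbT.
have -> : 4 * (k + 1) * C = 2 * (k + 1) * (k * (k - 1)).
  by rewrite -C2; clear; lia.
have -> : 2 * ((k + 1) * (l * (p * (i * (1 + 2 * (k + 1) * (k * (k - 1))))))) =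
    2 * (k + 1) * (1 + 2 * (k + 1) * (k * (k - 1))) * (l * (i * p)) by lia.
have -> : 4 * (k + 1) ^ 5 * l * (i * p) = 4 * (k + 1) ^ 5 * (l * (i * p)).
  by rewrite -!mulnA.
rewrite leq_mul2r; apply/orP; right.
have -> : (k + 1) ^ 5 = (k + 1) ^ 4 * (k + 1) by rewrite -expnSr.
by case: k k2 C2 {le} => // m _ _; rewrite subn1 /=; nia.
Qed.

End MinimalGraph.

(** * From the given graph to a minimal one, and the real bound *)

Lemma minimal_subgraph (T : finType) (E : {set {set T}}) (k : nat)
    (A0 : {set T}) :
  2 <= k -> k <= #|A0| ->
  (k - 1) * #|A0| + 2 <= edges_in E A0 + 'C(k, 2) ->
  exists (V : {set T}) (E' : {set {set T}}),
    [/\ V \subset A0, E' \subset E, k <= #|V|,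
        edges_in E' V + 'C(k, 2) = (k - 1) * #|V| + 2 &
        forall A : {set T}, A \proper V -> k <= #|A| ->
          edges_in E' A + 'C(k, 2) <= (k - 1) * #|A| + 1].
Proof.
move=> k2 kA eA.
pose P (V : {set T}) :=
  (k <= #|V|) && ((k - 1) * #|V| + 2 <= edges_in E V + 'C(k, 2)).
have PA : P A0 by apply/andP.
have [V /minsetP[/andP[kV eV] minV] VA] := minset_exists PA.
(* This makes the truncated subtraction in the number of retained edges exact. *)
have leC : 'C(k, 2) <= (k - 1) * #|V| + 2.
  have : (k - 1) * k <= (k - 1) * #|V| by rewrite leq_mul2l kV orbT.
  by have := double_bin2 k; rewrite mulnC; clear; lia.
have le : (k - 1) * #|V| + 2 - 'C(k, 2) <= edges_in E V by rewrite leq_subLR [leqRHS]addnC.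
have [E' sE' cE'] := subset_of_card le.
have E'E : E' \subset E.
  by apply: subset_trans sE' _; apply/subsetP => e; rewrite inE => /andP[].
exists V, E'; split=> //.
  have -> : edges_in E' V = #|E'|.
    apply: eq_card => e; rewrite inE; case: (boolP (e \in E')) => // eE'.
    by have := subsetP sE' e eE'; rewrite inE => /andP[].
  by rewrite cE' subnK.
move=> A AV kA'; rewrite leqNgt; apply/negP => lt.
have PAA : P A.
  rewrite /P kA' /=; apply: leq_trans (_ : edges_in E' A + 'C(k, 2) <= _); first by lia.
  rewrite leq_add2r; apply/subset_leq_card/subsetP => e.
  by rewrite !inE => /andP[/(subsetP E'E)-> ->].
by have := AV; rewrite (minV A PAA (proper_sub AV)) properxx.
Qed.

(** Translates the hypothesis on the number of edges into excess exactly 2. *)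
Lemma tk_excess (k n : nat) : 2 <= k -> k <= n ->
  tk k n + 1 + 'C(k, 2) = (k - 1) * n + 2.
Proof.
case: k => [|[|m]] // _ mn; rewrite /tk !subSS !subn0 !binS bin0 bin1.
have := double_bin2 m; move: 'C(m, 2) => c.
have [d ->] : exists d, n = m.+2 + d by exists (n - m.+2); rewrite subnKC.
by case: m {mn} => [|m] hc; nia.
Qed.

Definition induced_subgraph (T : finType) (E : {set {set T}})
    (E2 : forall e, e \in E -> #|e| = 2) (X : {set T}) : sgraph T.
Proof.
refine (@SGraph T X [set e in E | e \subset X] _).
by move=> e; rewrite inE => /andP[/E2].
Defined.

Import Order.TTheory GRing.Theory Num.Theory.

Lemma log2_ge_trunc_log (R : realType) (v n : nat) : 0 < v -> v <= n ->
  ((trunc_log 2 v)%:R <= log2 n%:R :> R)%R.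
Proof.
move=> v0 vn; have n0 : 0 < n := leq_trans v0 vn.
have ln2 : (0 < ln 2 :> R)%R by rewrite ln_gt0 // ltr1n.
rewrite /log2 ler_pdivlMr // mulr_natl -lnXn // ler_ln ?posrE ?exprn_gt0 ?ltr0n //.
by rewrite -natrX ler_nat (leq_trans _ vn) // trunc_logP.
Qed.

Lemma real_bound (R : realType) (k n v h : nat) :
  1 < v -> v <= n -> h <= v ->
  v <= 4 * (k + 1) ^ 5 * trunc_log 2 v * (v - h) ->
  (h%:R <= n%:R - n%:R / (4 * (k%:R + 1) ^+ 5 * log2 n%:R) :> R)%R.
Proof.
move=> v1 vn hv le; set A := 4 * (k + 1) ^ 5 * trunc_log 2 v in le.
have A0 : 0 < A by rewrite /A 2!muln_gt0 expn_gt0 addn1 trunc_log_gt0.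
(* Passing from [v] to [n] adds [n - v] on the left and [A * (n - v)] on the right, with [A] at
   least 1. *)
have le' : n <= A * (n - h).
  move: A A0 le; clear -vn hv => A A0 le.
  have -> : n - h = (n - v) + (v - h) by lia.
  by rewrite mulnDr; nia.
have AL : (A%:R <= 4 * (k%:R + 1) ^+ 5 * log2 n%:R :> R)%R.
  rewrite /A 2!natrM natrX natrD; apply: ler_wpM2l.
    by rewrite mulr_ge0 // exprn_ge0 // addr_ge0.
  by apply: log2_ge_trunc_log => //; apply: ltnW.
have A0' : (0 < A%:R :> R)%R by rewrite ltr0n.
have hn : h <= n := leq_trans hv vn.
rewrite lerBrDl -lerBrDr -natrB // ler_pdivrMr; last exact: lt_le_trans AL.
apply: (@le_trans _ _ ((n - h)%:R * A%:R)%R).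
  by rewrite -natrM ler_nat mulnC.
by apply: ler_wpM2l.
Qed.

Theorem theorem3 (R : realType) (T : finType) (k n : nat) (G : sgraph T)
    (hk : 2 <= k) (hn : k + 1 <= n)
    (hV : #|vertices G| = n)
    (hE : #|edges G| = tk k n + 1) :
  exists H : sgraph T,
    [/\ subgraph H G,
        vertices H != set0,
        k <= min_degree H &
        (#|vertices H|%:R <=
           n%:R - n%:R / (4 * (k%:R + 1) ^+ 5 * log2 n%:R) :> R)%R].
Proof.
have kn : k <= n by apply: leq_trans hn; rewrite leq_addr.
have eG : edges_in (edges G) (vertices G) = #|edges G|.
  apply: eq_card => e; rewrite inE; case: (boolP (e \in edges G)) => // eG.
  by have [] := edges_simple eG.
have [||V [E [VG EG kV eV minV]]] := @minimal_subgraph T (edges G) k (vertices G) hk.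
- by rewrite hV.
- by rewrite eG hV hE tk_excess.
have E2 e : e \in E -> #|e| = 2 by move=> /(subsetP EG)/edges_simple[].
have [X [XV X0 cX leX]] := minimal_graph_small_core E2 hk kV eV minV.
exists (induced_subgraph E2 X); split => //.
- split; first exact: subset_trans XV VG.
  by apply/subsetP => e; rewrite inE => /andP[/(subsetP EG)].
- apply/min_degreeP => // v vX; rewrite /degree card_incident //.
  exact: (coreP _ _ _ cX).
apply: real_bound leX.
- exact: leq_trans hk kV.
- by rewrite -hV subset_leq_card.
- exact: subset_leq_card.
Qed.
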